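(* Let $\gamma\geq\frac12$ if $d=1$, $\gamma>0$ if $d=2$ and $\gamma\geq0$ if $d\geq3$. Let $H=-\Delta+V(x)$ in $L^2(\mathbb{R}^d)$ with a complex-valued potential $V$, and let $\lambda_j$, $j=1,2,3,\ldots$, be the eigenvalues of $H$ in the cut plane $\mathbb{C}\setminus[0,\infty)$. Then: 1. For any eigenvalue $\lambda_j$ with non-positive real part $$(-\Re\lambda_j)^\gamma\leq L^1_{\gamma,d}\int_{\mathbb{R}^d}(\Re V(x))_-^{\gamma+d/2}\,dx$$ and $$|\lambda_j|^\gamma\leq C^1_{\gamma,d}\int_{\mathbb{R}^d}|V(x)|^{\gamma+d/2}\,dx .$$ 2. For any eigenvalue $\lambda_j$ with non-negative real part $$|\lambda_j|^\gamma\leq C^1_{\gamma,d}\left(1+\frac{2\Re\lambda_j}{|\Im\lambda_j|}\right)^{\gamma+d/2}\int_{\mathbb{R}^d}|V(x)|^{\gamma+d/2}\,dx .$$ Here $L^1_{\gamma,d}$ is the sharp constant in the bound on the bottom of the spectrum for real-valued potentials, and $C^1_{\gamma,d}=2^{\gamma/2+d/4}L^1_{\gamma,d}$.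
   Context: Notation: $t_-:=\max\{0,-t\}$ denotes the negative part of a real number $t$; $\Re$ and $\Im$ denote real and imaginary parts. Eigenvalues: $H=-\Delta+V$ is in general a non-self-adjoint Schrödinger operator in $L^2(\mathbb{R}^d)$. A number $\lambda\in\mathbb{C}$ is an eigenvalue of $H$ if $H\psi=\lambda\psi$ for some nonzero $\psi\in L^2(\mathbb{R}^d)$. Constant: $L^1_{\gamma,d}$ is the sharp (smallest possible) constant in the inequality $$\left(\inf\operatorname{spec}(-\Delta+W)\right)_-^\gamma\leq L^1_{\gamma,d}\int_{\mathbb{R}^d}W(x)_-^{\gamma+d/2}\,dx$$ for real-valued potentials $W$, where $\operatorname{spec}$ denotes the spectrum of the operator in $L^2(\mathbb{R}^d)$. This inequality is known to hold with a finite constant for $\gamma\geq\frac12$ if $d=1$, $\gamma>0$ if $d=2$ and $\gamma\geq0$ if $d\geq3$. *)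

(* Defs.v *)
From HB Require Import structures.
From mathcomp Require Import all_boot all_order all_algebra.
From mathcomp Require Import all_classical all_reals all_analysis.
From mathcomp Require Import complex.

Set Implicit Arguments.
Unset Strict Implicit.
Unset Printing Implicit Defensive.

Import Order.TTheory GRing.Theory Num.Theory.
Import numFieldNormedType.Exports.

Local Open Scope classical_set_scope.
Local Open Scope ring_scope.

Local Notation Re := complex.Re.
Local Notation Im := complex.Im.
Notation cnorm := ComplexField.Normc.normc.

(* R^d is 'rV[R]_d.  Its sigma-algebra is generated by the coordinates, as for
   n.-tuple in the library; since R is second countable this is the Borel
   sigma-algebra. *)
Definition rV_display : measure_display. Proof. exact: default_measure_display. Qed.

Section measurable_rV.
Context {R : realType}.
Variable n : nat.

Let coord : 'I_n -> 'rV[R]_n -> R := fun i x => x ord0 i.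

Let rV_set0 : g_sigma_preimage coord set0.
Proof. exact: sigma_algebra0. Qed.

Let rV_setC A : g_sigma_preimage coord A -> g_sigma_preimage coord (~` A).
Proof. exact: sigma_algebraC. Qed.

Let rV_bigcup (F : _^nat) : (forall i, g_sigma_preimage coord (F i)) ->
  g_sigma_preimage coord (\bigcup_i (F i)).
Proof. exact: sigma_algebra_bigcup. Qed.

HB.instance Definition _ := @isMeasurable.Build rV_display
  'rV[R]_n (g_sigma_preimage coord) rV_set0 rV_setC rV_bigcup.

Lemma measurable_coord (i : 'I_n) :
  measurable_fun [set: 'rV[R]_n] (fun x => x ord0 i).
Proof.
move=> _ Y mY; rewrite setTI; apply: sub_sigma_algebra => /=.
rewrite -bigcup_seq/=; exists i => /=; first by rewrite mem_index_enum.
by exists Y => //; rewrite setTI.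
Qed.

Lemma measurable_fun_rV d1 (T1 : measurableType d1) (f : T1 -> 'rV[R]_n) :
  (forall i, measurable_fun [set: T1] (fun x => f x ord0 i)) ->
  measurable_fun [set: T1] f.
Proof.
move=> mf; apply: (measurability
  (\big[setU/set0]_(i < n) preimage_set_system setT (coord i) measurable)) => //.
move=> _ [A + <-]; rewrite -bigcup_seq/= => -[i _ [Y mY <-]].
by rewrite !setTI; have := mf i measurableT _ mY; rewrite setTI.
Qed.

End measurable_rV.

Section lebesgue_rV_step.
Context {R : realType}.
Variable n : nat.

Definition rVcons (p : R * 'rV[R]_n) : 'rV[R]_n.+1 :=
  \row_i (if unlift ord0 i is Some j then p.2 ord0 j else p.1).

Definition rVuncons (v : 'rV[R]_n.+1) : R * 'rV[R]_n :=
  (v ord0 ord0, \row_j v ord0 (lift ord0 j)).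

Lemma rVconsK : cancel rVcons rVuncons.
Proof.
case=> x v; rewrite /rVuncons mxE unlift_none; congr pair.
by apply/rowP => j; rewrite !mxE liftK.
Qed.

Lemma measurable_rVcons : measurable_fun setT rVcons.
Proof.
apply: measurable_fun_rV => i.
case: (unliftP ord0 i) => [j ->|->].
  rewrite [X in measurable_fun _ X](_ : _ = (fun v : 'rV[R]_n => v ord0 j) \o snd).
    apply: measurableT_comp; first exact: measurable_coord.
    exact: measurable_snd.
  by apply/funext => p; rewrite /= mxE liftK.
rewrite [X in measurable_fun _ X](_ : _ = fst); first exact: measurable_fst.
by apply/funext => p; rewrite /= mxE unlift_none.
Qed.

Lemma measurable_rVuncons : measurable_fun setT rVuncons.
Proof.
apply: measurable_fun_pair; first exact: measurable_coord.
apply: measurable_fun_rV => i.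
rewrite [X in measurable_fun _ X](_ : _ =
  (fun v : 'rV[R]_n.+1 => v ord0 (lift ord0 i))); first exact: measurable_coord.
by apply/funext => v; rewrite /= mxE.
Qed.

Variable mu : {sigma_finite_measure set 'rV[R]_n -> \bar R}.

Definition lebesgue_rV_step : set 'rV[R]_n.+1 -> \bar R :=
  pushforward (lebesgue_measure \x mu)%E rVcons.

Let step0 : lebesgue_rV_step set0 = 0%E.
Proof. by rewrite /lebesgue_rV_step /pushforward preimage_set0 measure0. Qed.

Let step_ge0 A : (0 <= lebesgue_rV_step A)%E.
Proof. by rewrite /lebesgue_rV_step /pushforward measure_ge0. Qed.

Let step_sigma_additive : semi_sigma_additive lebesgue_rV_step.
Proof.
have mpre A : measurable A -> measurable (rVcons @^-1` A).
  by move=> mA; rewrite -[X in measurable X]setTI; exact: measurable_rVcons.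
move=> F mF tF mUF; rewrite /lebesgue_rV_step /pushforward preimage_bigcup.
apply: measure_semi_sigma_additive.
- by move=> k; exact: mpre.
- apply/trivIsetP => /= i j _ _ ij; rewrite -preimage_setI.
  by move/trivIsetP : tF => /(_ _ _ _ _ ij) ->//; rewrite preimage_set0.
- by rewrite -preimage_bigcup; exact: mpre.
Qed.

HB.instance Definition _ := isMeasure.Build _ _ _ lebesgue_rV_step
  step0 step_ge0 step_sigma_additive.

Let step_sigma_finite : sigma_finite setT lebesgue_rV_step.
Proof.
have /sigma_finiteP[F [FT ndF Foo]] := sigma_finiteT (@lebesgue_measure R).
have /sigma_finiteP[G [GT ndG Goo]] := sigma_finiteT mu.
exists (fun k => rVuncons @^-1` (F k `*` G k)).
  apply/seteqP; split => // v _.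
  have : (\bigcup_k F k) (rVuncons v).1 by rewrite -FT.
  have : (\bigcup_k G k) (rVuncons v).2 by rewrite -GT.
  move=> [l _ Gl] [k _ Fk]; exists (maxn k l) => //; split => /=.
    by move: Fk; exact/subsetPset/ndF/leq_maxl.
  by move: Gl; exact/subsetPset/ndG/leq_maxr.
move=> k; have [mFk Fk] := Foo k; have [mGk Gk] := Goo k; split.
  rewrite -[X in measurable X]setTI; apply: measurable_rVuncons => //.
  exact: measurableX.
rewrite /lebesgue_rV_step /pushforward.
rewrite -comp_preimage (_ : rVuncons \o rVcons = id); last first.
  by apply/funext => p; exact: rVconsK.
rewrite preimage_id.
by rewrite product_measure1E// lte_mul_pinfty// ge0_fin_numE.
Qed.

HB.instance Definition _ := Measure_isSigmaFinite.Build _ _ _ lebesgue_rV_step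
  step_sigma_finite.

End lebesgue_rV_step.

Fixpoint lebesgue_rV {R : realType} (n : nat) :
    {sigma_finite_measure set 'rV[R]_n -> \bar R} :=
  match n with
  | 0%N => (\d_(0 : 'rV[R]_0) : {sigma_finite_measure set 'rV[R]_0 -> \bar R})
  | m.+1 => (lebesgue_rV_step (lebesgue_rV m)
              : {sigma_finite_measure set 'rV[R]_m.+1 -> \bar R})
  end.

Lemma lebesgue_rV_box {R : realType} (n : nat) (A : 'I_n -> set R) :
  (forall i, measurable (A i)) ->
  lebesgue_rV n [set x | forall i, A i (x ord0 i)]
  = (\prod_(i < n) lebesgue_measure (A i))%E.
Proof.
elim: n A => [|n IHn] A mA.
  by rewrite big_ord0 /= diracE mem_set //= => -[].
have mbox : measurable [set x : 'rV[R]_n | forall i, A (lift ord0 i) (x ord0 i)].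
  rewrite [X in measurable X](_ : _ = \bigcap_(i in [set: 'I_n])
    ((fun x : 'rV[R]_n => x ord0 i) @^-1` A (lift ord0 i))).
    apply: fin_bigcap_measurable => // i _; rewrite -[X in measurable X]setTI.
    exact: measurable_coord.
  by apply/seteqP; split => x /= h i; [move=> _|]; exact: h.
rewrite big_ord_recl -IHn => [|i]; last exact: mA.
rewrite -product_measure1E /=; [|exact: mA|exact: mbox].
rewrite /lebesgue_rV_step /pushforward.
congr (product_measure1 _ _ _); apply/seteqP; split => -[x v] /=.
  move=> h; split => /=; first by have := h ord0; rewrite mxE unlift_none.
  by move=> i; have := h (lift ord0 i); rewrite mxE liftK.
move=> [h0 h] i; rewrite mxE.
by case: (unliftP ord0 i) => [j|] -> //=; exact: h.
Qed.

Section schroedinger.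
Context {R : realType} {d : nat}.
Local Notation Rd := 'rV[R]_d.
Local Notation leb := (lebesgue_rV d).
Implicit Types (f g psi phi eta u V : Rd -> R[i]).

Definition cmeasurable f :=
  measurable_fun setT (fun x => Re (f x)) /\
  measurable_fun setT (fun x => Im (f x)).

Definition cintegral f : R[i] :=
  Complex (\int[leb]_x Re (f x)) (\int[leb]_x Im (f x)).

Definition L2 f :=
  cmeasurable f /\ (\int[leb]_x ((cnorm (f x)) ^+ 2)%:E < +oo)%E.

Definition L2inner f g : R[i] := cintegral (fun x => f x * conjc (g x)).

Definition L2norm f : R := Num.sqrt (\int[leb]_x (cnorm (f x)) ^+ 2).

Definition partial (j : 'I_d) (chi : Rd -> R) : Rd -> R :=
  fun x => 'D_(delta_mx ord0 j) chi x.

Fixpoint Ck (k : nat) (chi : Rd -> R) : Prop :=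
  continuous chi /\
  match k with
  | 0%N => True
  | l.+1 => forall j : 'I_d,
      (forall x, derivable chi x (delta_mx ord0 j)) /\ Ck l (partial j chi)
  end.

Definition test_function (chi : Rd -> R) :=
  (forall k, Ck k chi) /\ compact (closure [set x | chi x != 0]).

(* The entries of G are the distributional partial derivatives of psi. *)
Definition weak_gradient psi (G : 'I_d -> Rd -> R[i]) :=
  forall j, L2 (G j) /\
    forall chi, test_function chi ->
      cintegral (fun x => psi x * (partial j chi x)%:C%C)
      = - cintegral (fun x => G j x * (chi x)%:C%C).

Definition H1 psi := L2 psi /\ exists G, weak_gradient psi G.

Definition L1loc V :=
  cmeasurable V /\
  forall K : set Rd, compact K -> (\int[leb]_(x in K) (cnorm (V x))%:E < +oo)%E.

Definition form_domain V psi :=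
  H1 psi /\ (\int[leb]_x (cnorm (V x) * (cnorm (psi x)) ^+ 2)%:E < +oo)%E.

(* schroedinger V psi eta means: psi lies in the domain of H = -Delta + V and
   H psi = eta, H being the operator associated with the sesquilinear form
   int grad psi . conj (grad phi) + int V psi conj phi on form_domain V.  This
   domain is dense in L^2 as V is in L^1_loc, and is all of H^1 when |V| is
   form-bounded.  Elements of L^2 are represented by functions, so H is a
   relation compatible with equality almost everywhere; G and F range over the
   representatives of the two weak gradients. *)
Definition schroedinger V psi eta :=
  [/\ form_domain V psi, L2 eta &
      forall phi G F, form_domain V phi ->
        weak_gradient psi G -> weak_gradient phi F ->
        \sum_(j < d) L2inner (G j) (F j) + L2inner (fun x => V x * psi x) phi
        = L2inner eta phi].

Definition schroedinger_eigenvalue V (lambda : R[i]) :=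
  exists psi, [/\ L2 psi, ~ {ae leb, forall x, psi x = 0} &
    schroedinger V psi (fun x => lambda * psi x)].

(* H - z is a bijection from the domain of H onto L^2 with bounded inverse. *)
Definition resolvent_set V : set R[i] := [set z |
  (forall u, schroedinger V u (fun x => z * u x) ->
     {ae leb, forall x, u x = 0}) /\
  exists M : R, forall f, L2 f -> exists u,
    schroedinger V u (fun x => z * u x + f x) /\ L2norm u <= M * L2norm f].

Definition spectrum V : set R[i] := ~` resolvent_set V.

(* For W in L^1_loc with W_- in L^p, p = gamma + d/2 in the range of the
   inequality below, the form is closed and bounded from below and the operator
   is self-adjoint, so that its spectrum is real. *)
Definition inf_spec (W : Rd -> R) : \bar R :=
  ereal_inf [set s%:E | s in
    [set s : R | spectrum (fun x => (W x)%:C%C) s%:C%C]].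

End schroedinger.

Definition neg_part {R : realType} (t : R) : R := Num.max 0 (- t).

(* t_-^gamma with 0^gamma = 0 for every gamma >= 0.  At gamma = 0 this makes it
   the indicator of t < 0; with 0^0 = 1 the inequality in sharp_constant would
   fail for W = 0. *)
Definition neg_pow {R : realType} (t : \bar R) (gamma : R) : \bar R :=
  (if t < 0 then (- t) `^ gamma else 0)%E.

(* L^1_{gamma,d}; the value would be +oo if no finite constant were admissible.
   W ranges over L^1_loc; a W with infinite right-hand side puts no constraint
   on C > 0. *)
Definition sharp_constant {R : realType} (gamma : R) (d : nat) : \bar R :=
  ereal_inf [set C%:E | C in [set C : R | 0 <= C /\
    forall W : 'rV[R]_d -> R, L1loc (fun x => (W x)%:C%C) ->
      (neg_pow (inf_spec W) gamma <=
       C%:E * \int[lebesgue_rV d]_x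
                (neg_part (W x) `^ (gamma + d%:R / 2))%:E)%E]].

(* C^1_{gamma,d} *)
Definition complex_constant {R : realType} (gamma : R) (d : nat) : \bar R :=
  ((2 `^ (gamma / 2 + d%:R / 4))%:E * sharp_constant gamma d)%E.

(* Main.v *)
(* Testing the eigenvalue equation H psi = lambda psi with psi itself and taking
   Re + t Im shows that psi has Rayleigh quotient mu = Re lambda + t Im lambda
   for the real potential U = Re V + t Im V.  With t = 0, or
   t = -/+ (1 + 2 Re lambda / |Im lambda|), or t = -/+ 1, this is negative, and
   the variational principle together with the inequality defining the sharp
   constant bounds (- mu)^gamma.

   To apply the variational principle without any Sobolev inequality, U is
   replaced by max(U, - n 1_(A n)) with A n an exhaustion by sets of finite
   measure: the form is then bounded below for a trivial reason, the right-hand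
   side is finite and at most that of U, and the Rayleigh quotient of psi
   converges to mu by dominated convergence.  These truncations also show that
   the sharp constant is positive, which matters because 0 * +oo = 0 in \bar R.
   That it is finite is never needed: if the integral of the power of U_- is 0
   then U >= 0 almost everywhere, contradicting mu < 0.

   For the variational principle let s be the infimum of the Rayleigh quotients
   of a semibounded form q.  If s were in the resolvent set, u = (H - s)^-1 phi
   would satisfy q(u, .) - s <u, .> = <phi, .>; expanding the nonnegative form
   q - s at phi - c u with c > 0 small gives q(phi) - s |phi|^2 >= c |phi|^2 with
   c independent of phi, contradicting the choice of s. *)
Require Import Defs.
From HB Require Import structures.
From mathcomp Require Import all_boot all_order all_algebra.
From mathcomp Require Import all_classical all_reals all_analysis.
From mathcomp Require Import measurable_realfun complex ring lra.

Import Order.TTheory GRing.Theory Num.Theory.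
Import numFieldNormedType.Exports.

Local Open Scope classical_set_scope.
Local Open Scope ring_scope.

(** * Measurability in R^d and square integrability of test functions *)

Section test_functions.
Context {R : realType} {d : nat}.
Local Notation Rd := 'rV[R]_d.
Local Notation leb := (lebesgue_rV d).

(** Multi-index of the half-open cube of side 1/(n+1) that contains [x]. *)
Definition grid_index (n : nat) (x : Rd) : 'rV[int]_d :=
  \row_i Num.floor (n.+1%:R * x ord0 i).

(** The norm is the maximum over the coordinates, and reals with equal floor differ by less than
    1. *)
Lemma grid_index_dist n (x y : Rd) :
  grid_index n x = grid_index n y -> `|x - y| <= n.+1%:R^-1.
Proof.
move=> /rowP xy; rewrite [leLHS]/Num.norm/= mx_normrE; apply/bigmax_leP.
split; first by rewrite invr_ge0 ler0n.
move=> [i0 i] _ /=; rewrite !mxE (ord1 i0); have := xy i; rewrite !mxE.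
set a := x ord0 i; set b := y ord0 i => ab.
have n0 : 0 < n.+1%:R :> R by rewrite ltr0n.
have /andP[la ra] := floor_itv (n.+1%:R * a).
have := floor_itv (n.+1%:R * b); rewrite -ab => /andP[lb rb].
rewrite -(ler_pM2l n0) mulfV ?gt_eqF// -[X in X * _]gtr0_norm// -normrM mulrBr.
rewrite intrD in ra rb.
by rewrite ler_norml; apply/andP; split; lra.
Qed.

Lemma measurable_grid_cell n (k : 'rV[int]_d) :
  measurable [set x : Rd | grid_index n x = k].
Proof.
rewrite [X in measurable X](_ : _ = \bigcap_(i in [set: 'I_d])
  ((fun x : Rd => x ord0 i) @^-1` [set y | Num.floor (n.+1%:R * y) = k ord0 i])).
  apply: fin_bigcap_measurable => // i _; rewrite -[X in measurable X]setTI.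
  apply: measurable_coord => //.
  rewrite [X in measurable X](_ : _ = `[(k ord0 i)%:~R / n.+1%:R,
     (k ord0 i + 1)%:~R / n.+1%:R[%classic) //.
  apply/seteqP; split=> y /=; rewrite in_itv/= ler_pdivrMr ?ltr0n//
    ltr_pdivlMr ?ltr0n// ![y * _]mulrC.
    by move=> <-; exact: floor_itv.
  by move=> h; apply: floor_def.
apply/seteqP; split => x /=.
  by move=> <- i _; rewrite mxE.
by move=> h; apply/rowP => i; rewrite mxE h.
Qed.

(* An open set is the union of the grid cells, of all mesh sizes, that it
   contains; there are countably many of them. *)
Lemma open_measurable_rV (O : set Rd) : open O -> measurable O.
Proof.
move=> oO; pose cell n k := [set x : Rd | grid_index n x = k].
rewrite [X in measurable X](_ : _ = \bigcup_n \bigcup_(k : 'rV[int]_d)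
    [set x | cell n k x /\ cell n k `<=` O]); last first.
  apply/seteqP; split=> [x Ox|x [n _ [k _ [kx]]]]; last exact.
  have [e /= e0 eO] : nbhs_ball x O.
    by apply/nbhs_ballP; move: oO; rewrite openE; exact.
  have [n _ /(_ _ (leqnn n)) /= ne] := near_infty_natSinv_lt (PosNum e0).
  exists n => //; exists (grid_index n x) => //; split=> // y yx.
  apply: eO; rewrite -ball_normE /=; apply: le_lt_trans ne.
  exact/grid_index_dist/esym.
apply: bigcupT_measurable => n.
apply: countable_bigcupT_measurable => [|k]; first exact: countableP.
have [h|h] := pselect (cell n k `<=` O).
  rewrite [X in measurable X](_ : _ = cell n k); first exact: measurable_grid_cell.
  by apply/seteqP; split=> x //= [].
by rewrite [X in measurable X](_ : _ = set0)//; apply/seteqP; split=> x //= [].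
Qed.

Lemma measurable_continuous_rV (f : Rd -> R) :
  continuous f -> measurable_fun setT f.
Proof.
move=> /continuousP cf; apply: (measurability _ (RGenOpens.measurableE R)).
move=> _ [_ [a [b ->] <-]]; rewrite setTI; apply: open_measurable_rV.
exact/cf/interval_open.
Qed.

Lemma compact_measurable_rV (K : set Rd) : compact K -> measurable K.
Proof.
move=> /(compact_closed (@norm_hausdorff _ _))/closed_openC/open_measurable_rV.
by move/measurableC; rewrite setCK.
Qed.

(** A large enough cube works: its measure is a finite product of finite lengths. *)
Lemma bounded_finite_measure (K : set Rd) : bounded_set K ->
  exists B, [/\ measurable B, (leb B < +oo)%E & K `<=` B].
Proof.
move=> [M0 [_ /(_ (`|M0| + 1))]].
rewrite (le_lt_trans (ler_norm _)) ?ltrDl// => /(_ isT).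
move: (`|M0| + 1) => M KM.
exists [set x : Rd | forall i, `[- M, M]%classic (x ord0 i)]; split.
- rewrite [X in measurable X](_ : _ = \bigcap_(i in [set: 'I_d])
    ((fun x : Rd => x ord0 i) @^-1` `[- M, M]%classic)).
    apply: fin_bigcap_measurable => // i _; rewrite -[X in measurable X]setTI.
    exact: measurable_coord.
  by apply/seteqP; split => x /= h i; [move=> _|]; exact: h.
- rewrite (@lebesgue_rV_box R d (fun=> `[- M, M]%classic)) => [|_]; last exact: measurable_itv.
  suff /andP[] : (0 <= \prod_(i < d) lebesgue_measure `[(- M)%R, M]%classic < +oo)%E by [].
  elim/big_ind : _ => [|x y /andP[x0 xoo] /andP[y0 yoo]|i _].
  - by rewrite lee_fin ler01 ltry.
  - by rewrite mule_ge0// lte_mul_pinfty// ge0_fin_numE.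
  - rewrite measure_ge0/= lebesgue_measure_itv/=.
    by case: ifP => _; rewrite -?EFinD ltry.
- move=> x /KM /= xM i; rewrite /= in_itv/= -ler_norml.
  apply: le_trans xM; rewrite /Num.norm/= mx_normrE.
  exact: (le_bigmax _ (fun ij : 'I_1 * 'I_d => `|x ij.1 ij.2|) (ord0, i)).
Qed.

(** Continuity bounds |h| by some [M] on [K], so [M ^+ 2] times the indicator of a box around [K]
    dominates the square. *)
Lemma compact_support_sqr_integrable (K : set Rd) (h : Rd -> R) :
  compact K -> continuous h -> (forall x, ~ K x -> h x = 0) ->
  leb.-integrable setT (fun x => (h x ^+ 2)%:E).
Proof.
move=> cK ch hK.
have [B [mB Boo KB]] := bounded_finite_measure _ (compact_bounded cK).
have [M0 [_ /(_ (`|M0| + 1))]] : bounded_set (h @` K).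
  by apply/compact_bounded/continuous_compact => //; exact: continuous_subspaceT.
rewrite (le_lt_trans (ler_norm _)) ?ltrDl// => /(_ isT).
move: (`|M0| + 1) => M hM.
have mh := measurable_continuous_rV _ ch.
apply: (@le_integrable _ _ _ _ setT measurableT _
  (fun x => ((M ^+ 2)%:E * (\1_B x)%:E)%E)).
- by apply/measurable_EFinP; exact: measurable_funX.
- move=> x _; rewrite -EFinM !abse_EFin lee_fin !ger0_norm ?sqr_ge0//; last first.
    by rewrite mulr_ge0 ?sqr_ge0//.
  have [Kx|nKx] := pselect (K x); last first.
    by rewrite hK// expr0n/= mulr_ge0 ?sqr_ge0.
  rewrite indicE mem_set ?mulr1; last exact: KB.
  have hx : `|h x| <= M by apply: hM; exists x.
  by rewrite -real_normK ?num_real// lerXn2r// nnegrE (le_trans _ hx).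
- apply: integrableZl => //; apply/integrableP; split; first exact/measurable_EFinP.
  under eq_integral do rewrite abse_EFin ger0_norm//.
  by rewrite integral_indic// setIT.
Qed.

Lemma test_function_sqr_integrable (chi : Rd -> R) : test_function chi ->
  measurable_fun setT chi /\ leb.-integrable setT (fun x => (chi x ^+ 2)%:E).
Proof.
move=> [/(_ 0%N)[cchi _] csupp]; split; first exact: measurable_continuous_rV.
apply: compact_support_sqr_integrable _ _ csupp cchi _ => x nx; apply/eqP.
by apply/negPn/negP => chix; apply: nx; exact: subset_closure.
Qed.

Lemma partial_test_function_sqr_integrable (chi : Rd -> R) (j : 'I_d) :
  test_function chi ->
  measurable_fun setT (partial j chi) /\
  leb.-integrable setT (fun x => (partial j chi x ^+ 2)%:E).
Proof.
move=> [/(_ 1%N)[_ /(_ j)[_ [cchi _]]] csupp].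
split; first exact: measurable_continuous_rV.
apply: compact_support_sqr_integrable _ _ csupp cchi _ => x nx.
(* The complement of the support is open, so [chi] vanishes near [x] and has there the derivative of
   the constant 0. *)
rewrite /partial (@near_eq_derive _ _ _ chi (cst 0)) ?derive_cst//.
have : open (~` closure [set y | chi y != 0]) by apply/closed_openC/closed_closure.
rewrite openE => /(_ _ nx); apply: filterS => y ny; apply/eqP.
by apply/negPn/negP => chiy; apply: ny; exact: subset_closure.
Qed.

End test_functions.

(** * Weighted real inner products of complex-valued functions *)

Section weighted_products.
Context {R : realType} {d : nat}.
Local Notation Rd := 'rV[R]_d.
Local Notation leb := (lebesgue_rV d).
Local Notation Re := complex.Re.
Local Notation Im := complex.Im.
Implicit Types (w h : Rd -> R) (f g u : Rd -> R[i]).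

Lemma integrableZl_fin k h : leb.-integrable setT (fun x => (h x)%:E) ->
  leb.-integrable setT (fun x => (k * h x)%:E).
Proof. by move=> ih; under eq_fun do rewrite EFinM; exact: integrableZl. Qed.

Lemma integrableD_fin h1 h2 : leb.-integrable setT (fun x => (h1 x)%:E) ->
  leb.-integrable setT (fun x => (h2 x)%:E) ->
  leb.-integrable setT (fun x => (h1 x + h2 x)%:E).
Proof. by move=> i1 i2; under eq_fun do rewrite EFinD; exact: integrableD. Qed.

(** This is Re (z conj z'), the Euclidean inner product of the plane. *)
Definition rdot (z z' : R[i]) : R := Re z * Re z' + Im z * Im z'.

Lemma rdotC z z' : rdot z z' = rdot z' z.
Proof. by rewrite /rdot mulrC [X in _ + X]mulrC. Qed.

Lemma rdot_ge0 z : 0 <= rdot z z.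
Proof. by rewrite /rdot -!expr2 addr_ge0// sqr_ge0. Qed.

Lemma cnorm_ge0 (z : R[i]) : 0 <= cnorm z.
Proof. by case: z => a b /=; rewrite sqrtr_ge0. Qed.

Lemma cnorm_sqr (z : R[i]) : cnorm z ^+ 2 = rdot z z.
Proof.
by case: z => a b /=; rewrite sqr_sqrtr ?addr_ge0 ?sqr_ge0// /rdot/= !expr2.
Qed.

(** Expand |z + z'|^2 >= 0 and |z - z'|^2 >= 0. This crude bound stands in for Cauchy-Schwarz in the
    integrability arguments. *)
Lemma rdot_le z z' : `|rdot z z'| <= rdot z z + rdot z' z'.
Proof.
case: z z' => a b [c e]; rewrite /rdot/= ler_norml; apply/andP; split.
  rewrite -subr_ge0 opprK.
  have := sqr_ge0 (a + c); have := sqr_ge0 (b + e).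
  have := sqr_ge0 a; have := sqr_ge0 b; have := sqr_ge0 c; have := sqr_ge0 e.
  rewrite !expr2; nra.
have := sqr_ge0 (a - c); have := sqr_ge0 (b - e).
have := sqr_ge0 a; have := sqr_ge0 b; have := sqr_ge0 c; have := sqr_ge0 e.
rewrite !expr2; nra.
Qed.

Lemma normr_Re_le (z : R[i]) : `|Re z| <= cnorm z.
Proof. by case: z => a b /=; rewrite -sqrtr_sqr ler_wsqrtr// lerDl sqr_ge0. Qed.

Lemma normr_Im_le (z : R[i]) : `|Im z| <= cnorm z.
Proof. by case: z => a b /=; rewrite -sqrtr_sqr ler_wsqrtr// lerDr sqr_ge0. Qed.

(** The weight may change sign, so that potentials can serve as weights; integrability means that
    |w| |f|^2 has a finite integral. *)
Definition wL2 w f :=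
  cmeasurable f /\ leb.-integrable setT (fun x => (w x * rdot (f x) (f x))%:E).

Definition wdot w f g : R := \int[leb]_x (w x * rdot (f x) (g x)).

Definition radd f (t : R) g : Rd -> R[i] := fun x => f x + t%:C%C * g x.

Lemma Re_radd f t g x : Re (radd f t g x) = Re (f x) + t * Re (g x).
Proof. by rewrite /radd; case: (f x) (g x) => a b [c e] /=; rewrite mul0r subr0. Qed.

Lemma Im_radd f t g x : Im (radd f t g x) = Im (f x) + t * Im (g x).
Proof. by rewrite /radd; case: (f x) (g x) => a b [c e] /=; rewrite mul0r addr0. Qed.

Lemma measurable_rdot f g : cmeasurable f -> cmeasurable g ->
  measurable_fun setT (fun x => rdot (f x) (g x)).
Proof.
by move=> [f1 f2] [g1 g2]; apply: measurable_funD; exact: measurable_funM.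
Qed.

Lemma cmeasurable_radd f t g :
  cmeasurable f -> cmeasurable g -> cmeasurable (radd f t g).
Proof.
move=> [f1 f2] [g1 g2]; split.
  under eq_fun do rewrite Re_radd.
  by apply: measurable_funD => //; exact: measurable_funM.
under eq_fun do rewrite Im_radd.
by apply: measurable_funD => //; exact: measurable_funM.
Qed.

(** By [rdot_le] the product is dominated by |w| (|f|^2 + |g|^2). *)
Lemma wdot_integrable w f g : measurable_fun setT w -> wL2 w f -> wL2 w g ->
  leb.-integrable setT (fun x => (w x * rdot (f x) (g x))%:E).
Proof.
move=> mw [mf If] [mg Ig].
apply: (@le_integrable _ _ _ _ setT measurableT _
  ((abse \o (fun x => (w x * rdot (f x) (f x))%:E)) \+
   (abse \o (fun x => (w x * rdot (g x) (g x))%:E)))%E).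
- by apply/measurable_EFinP; apply: measurable_funM => //; exact: measurable_rdot.
- move=> x _; rewrite -EFinD !abse_EFin lee_fin !normrM -mulrDr normrM normr_id.
  rewrite ler_wpM2l// [leRHS]ger0_norm ?addr_ge0//.
  by rewrite !(ger0_norm (rdot_ge0 _)) rdot_le.
- by apply: integrableD => //; exact: integrable_abse.
Qed.

Lemma wL2_radd w f t g : measurable_fun setT w -> wL2 w f -> wL2 w g ->
  wL2 w (radd f t g).
Proof.
move=> mw wf wg; have wfg := wdot_integrable _ _ _ mw wf wg.
split; first by apply: cmeasurable_radd; [case: wf|case: wg].
rewrite [X in integrable _ _ X](_ : _ = fun x => (w x * rdot (f x) (f x) +
  (2 * t * (w x * rdot (f x) (g x)) + t ^+ 2 * (w x * rdot (g x) (g x))))%:E); last first.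
  by apply/funext => x; congr EFin; rewrite /rdot Re_radd Im_radd; ring.
apply: integrableD_fin; first by case: wf.
by apply: integrableD_fin; apply: integrableZl_fin => //; case: wg.
Qed.

Lemma wdot_radd w f t g : measurable_fun setT w -> wL2 w f -> wL2 w g ->
  wdot w (radd f t g) (radd f t g) =
  wdot w f f + 2 * t * wdot w f g + t ^+ 2 * wdot w g g.
Proof.
move=> mw wf wg; have wfg := wdot_integrable _ _ _ mw wf wg.
have [_ If] := wf; have [_ Ig] := wg.
rewrite /wdot -!RintegralZl// -!RintegralD//; first last.
- exact: integrableZl_fin.
- exact: integrableZl_fin.
- by apply: integrableD_fin => //; exact: integrableZl_fin.
by apply: eq_Rintegral => x _; rewrite /rdot Re_radd Im_radd; ring.
Qed.

Lemma wdot_ge0 w f : (forall x, 0 <= w x) -> 0 <= wdot w f f.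
Proof. by move=> w0; apply: Rintegral_ge0 => x _; rewrite mulr_ge0// rdot_ge0. Qed.

(** Turns L^2 into the case of weight 1 of the weighted spaces. *)
Lemma L2_wL2 f : L2 f <-> wL2 (cst 1) f.
Proof.
have E : (fun x => (cst 1 x * rdot (f x) (f x))%:E) = (fun x => (cnorm (f x) ^+ 2)%:E).
  by apply/funext => x; rewrite mul1r cnorm_sqr.
rewrite /wL2 E; split => -[mf fi]; split => //.
  apply/integrableP; split.
    apply/measurable_EFinP; under eq_fun do rewrite cnorm_sqr.
    exact: measurable_rdot.
  by under eq_integral do rewrite abse_EFin ger0_norm ?sqr_ge0//.
move/integrableP : fi => [_].
by under eq_integral do rewrite abse_EFin ger0_norm ?sqr_ge0//.
Qed.

Lemma L2norm_sqr f : L2norm f ^+ 2 = wdot (cst 1) f f.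
Proof.
rewrite sqr_sqrtr; last by apply: Rintegral_ge0 => x _; rewrite sqr_ge0.
by apply: eq_Rintegral => x _; rewrite cnorm_sqr mul1r.
Qed.

Lemma Re_L2inner_real w f g : Re (L2inner (fun x => (w x)%:C%C * f x) g) = wdot w f g.
Proof.
apply: eq_Rintegral => x _; rewrite /rdot.
by case: (f x) (g x) => a b [c e] /=; ring.
Qed.

Lemma Re_L2inner f g : Re (L2inner f g) = wdot (cst 1) f g.
Proof.
rewrite -Re_L2inner_real; congr (Re (L2inner _ _)).
by apply/funext => x; rewrite mul1r.
Qed.

Lemma Re_L2inner_radd f t g u : L2 f -> L2 g -> L2 u ->
  Re (L2inner (radd f t g) u) = wdot (cst 1) f u + t * wdot (cst 1) g u.
Proof.
move=> /L2_wL2 Lf /L2_wL2 Lg /L2_wL2 Lu; rewrite Re_L2inner.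
have m1 : measurable_fun setT (cst 1 : Rd -> R) by [].
have fu := wdot_integrable _ _ _ m1 Lf Lu; have gu := wdot_integrable _ _ _ m1 Lg Lu.
rewrite /wdot -RintegralZl// -RintegralD//; last exact: integrableZl_fin.
by apply: eq_Rintegral => x _; rewrite /rdot Re_radd Im_radd; ring.
Qed.

Lemma mul_sqr_integrable (h1 h2 : Rd -> R) :
  measurable_fun setT h1 -> measurable_fun setT h2 ->
  leb.-integrable setT (fun x => (h1 x ^+ 2)%:E) ->
  leb.-integrable setT (fun x => (h2 x ^+ 2)%:E) ->
  leb.-integrable setT (fun x => (h1 x * h2 x)%:E).
Proof.
move=> m1 m2 i1 i2.
have E h (mh : measurable_fun setT h) (ih : leb.-integrable setT (fun x => (h x ^+ 2)%:E)) :
    wL2 (cst 1) (fun x => (h x)%:C%C).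
  split; first by split.
  rewrite [X in integrable _ _ X](_ : _ = fun x => (h x ^+ 2)%:E)//.
  by apply/funext => x; rewrite /rdot/= mul0r addr0 mul1r expr2.
have m0 : measurable_fun setT (cst 1 : Rd -> R) by [].
have := wdot_integrable _ _ _ m0 (E _ m1 i1) (E _ m2 i2).
by under eq_fun do rewrite /rdot/= mul0r addr0 mul1r.
Qed.

Lemma L2_sqr_integrable f : L2 f ->
  [/\ measurable_fun setT (fun x => Re (f x)), measurable_fun setT (fun x => Im (f x)),
      leb.-integrable setT (fun x => (Re (f x) ^+ 2)%:E) &
      leb.-integrable setT (fun x => (Im (f x) ^+ 2)%:E)].
Proof.
move=> /L2_wL2[[mr mi] I]; split => //.
all: apply: le_integrable I => //; first by apply/measurable_EFinP; exact: measurable_funX.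
all: move=> x _; rewrite !abse_EFin lee_fin mul1r !ger0_norm ?rdot_ge0 ?sqr_ge0//.
all: by rewrite /rdot -!expr2 ?lerDl ?lerDr sqr_ge0.
Qed.

(** Products of two square integrable functions are integrable, so the integrals may be split. *)
Lemma cintegral_radd_test f t g h : L2 f -> L2 g -> measurable_fun setT h ->
  leb.-integrable setT (fun x => (h x ^+ 2)%:E) ->
  cintegral (fun x => radd f t g x * (h x)%:C%C) =
  cintegral (fun x => f x * (h x)%:C%C) +
  t%:C%C * cintegral (fun x => g x * (h x)%:C%C).
Proof.
move=> /L2_sqr_integrable[fr fi Ifr Ifi] /L2_sqr_integrable[gr gi Igr Igi] mh ih.
have ReM (k : Rd -> R[i]) x : Re (k x * (h x)%:C%C) = Re (k x) * h x.
  by case: (k x) => a b /=; rewrite mulr0 subr0.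
have ImM (k : Rd -> R[i]) x : Im (k x * (h x)%:C%C) = Im (k x) * h x.
  by case: (k x) => a b /=; rewrite mulr0 add0r.
have E k : cintegral (fun x => k x * (h x)%:C%C) =
   Complex (\int[leb]_x (Re (k x) * h x)) (\int[leb]_x (Im (k x) * h x)).
  by congr Complex; apply: eq_Rintegral => x _; rewrite ?ReM ?ImM.
rewrite !E; apply/eqP; rewrite eq_complex /=; apply/andP; split; apply/eqP.
  rewrite mul0r subr0 -RintegralZl//; last exact: mul_sqr_integrable.
  rewrite -RintegralD//; last 2 first.
  - exact: mul_sqr_integrable.
  - by apply: integrableZl_fin => //; exact: mul_sqr_integrable.
  by apply: eq_Rintegral => x _; rewrite Re_radd; ring.
rewrite mul0r addr0 -RintegralZl//; last exact: mul_sqr_integrable.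
rewrite -RintegralD//; last 2 first.
- exact: mul_sqr_integrable.
- by apply: integrableZl_fin => //; exact: mul_sqr_integrable.
by apply: eq_Rintegral => x _; rewrite Im_radd; ring.
Qed.

Lemma weak_gradient_radd f F t g G : L2 f -> L2 g ->
  weak_gradient f F -> weak_gradient g G ->
  weak_gradient (radd f t g) (fun j => radd (F j) t (G j)).
Proof.
move=> Lf Lg wF wG j; have [LF pF] := wF j; have [LG pG] := wG j; split.
  by apply/L2_wL2; apply: wL2_radd => //; apply/L2_wL2.
move=> chi tchi.
have [m1 i1] := test_function_sqr_integrable _ tchi.
have [m2 i2] := partial_test_function_sqr_integrable _ j tchi.
by rewrite !cintegral_radd_test// pF// pG// mulrN opprD.
Qed.

End weighted_products.

(** * The quadratic form and the variational principle *)

Section variational_principle.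
Context {R : realType} {d : nat}.
Local Notation Rd := 'rV[R]_d.
Local Notation leb := (lebesgue_rV d).
Local Notation Re := complex.Re.
Local Notation Im := complex.Im.
Implicit Types (w W : Rd -> R) (f g u phi psi V : Rd -> R[i])
  (F G : 'I_d -> Rd -> R[i]).

Lemma wdotC w f g : wdot w f g = wdot w g f.
Proof. by apply: eq_Rintegral => x _; rewrite rdotC. Qed.

Lemma wdot1_le f g : L2 f -> L2 g ->
  wdot (cst 1) f g <= wdot (cst 1) f f + wdot (cst 1) g g.
Proof.
move=> /L2_wL2 Lf /L2_wL2 Lg.
rewrite /wdot -RintegralD//; [|by case: Lf|by case: Lg].
apply: le_Rintegral => //.
- exact: (wdot_integrable _ _ _ _ Lf Lg).
- by apply: integrableD_fin; [case: Lf|case: Lg].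
- by move=> x _; rewrite !mul1r (le_trans (ler_norm _))// rdot_le.
Qed.

Lemma cnormE (z : R[i]) : cnorm z = Num.sqrt (rdot z z).
Proof. by rewrite -cnorm_sqr sqrtr_sqr ger0_norm// cnorm_ge0. Qed.

Lemma measurable_cnorm f : cmeasurable f -> measurable_fun setT (fun x => cnorm (f x)).
Proof.
move=> mf; rewrite (_ : (fun _ => _) = Num.sqrt \o (fun x => rdot (f x) (f x))).
  apply: measurableT_comp; last exact: measurable_rdot.
  by apply: continuous_measurable_fun; exact: sqrt_continuous.
by apply/funext => x; rewrite cnormE.
Qed.

(** Serves for [w] equal to Re V, Im V, their real combinations and the truncations of these, all
    dominated by a multiple of |V|. *)
Lemma form_domain_wL2 V w (k : R) psi :
  measurable_fun setT w -> cmeasurable V ->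
  (forall x, `|w x| <= k * cnorm (V x)) -> form_domain V psi -> wL2 w psi.
Proof.
move=> mw [mVr mVi] wV [[[mpsi _] _] fin]; split => //.
have mV : measurable_fun setT (fun x => cnorm (V x)) by exact: measurable_cnorm.
have If : leb.-integrable setT (fun x => (cnorm (V x) * cnorm (psi x) ^+ 2)%:E).
  apply/integrableP; split.
    apply/measurable_EFinP; apply: measurable_funM => //.
    by under eq_fun do rewrite cnorm_sqr; exact: measurable_rdot.
  by under eq_integral do rewrite abse_EFin ger0_norm ?mulr_ge0 ?sqr_ge0 ?cnorm_ge0//.
apply: (le_integrable measurableT _ _ (integrableZl_fin k _ If)).
  by apply/measurable_EFinP; apply: measurable_funM => //; exact: measurable_rdot.
move=> x _; rewrite !abse_EFin lee_fin normrM cnorm_sqr mulrA normrM.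
by rewrite ler_wpM2r// (le_trans (wV x))// ler_norm.
Qed.

Lemma cnorm_real (a : R) : cnorm a%:C%C = `|a|.
Proof. by rewrite /= expr0n/= addr0 sqrtr_sqr. Qed.

Lemma form_domain_realP W psi : measurable_fun setT W ->
  form_domain (fun x => (W x)%:C%C) psi <-> H1 psi /\ wL2 W psi.
Proof.
move=> mW; split => [Wpsi|[Hpsi [mpsi /integrableP[_ fin]]]].
  split; first by case: Wpsi.
  apply: (form_domain_wL2 (fun x => (W x)%:C%C) W 1) => //.
  by move=> x; rewrite cnorm_real mul1r.
split => //; move: fin; congr (_ < _)%E; apply: eq_integral => x _.
by rewrite cnorm_real cnorm_sqr abse_EFin normrM (ger0_norm (rdot_ge0 _)).
Qed.

(** Real part of the sesquilinear form. The weak gradients are arguments because they are determined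
    only almost everywhere. *)
Definition form W u G phi F : R :=
  \sum_(j < d) wdot (cst 1) (G j) (F j) + wdot W u phi.

Lemma formC W u G phi F : form W u G phi F = form W phi F u G.
Proof. by rewrite /form wdotC; congr (_ + _); apply: eq_bigr => j _; rewrite wdotC. Qed.

Lemma form_radd W phi F t u G : measurable_fun setT W ->
  (forall j, L2 (F j)) -> (forall j, L2 (G j)) -> wL2 W phi -> wL2 W u ->
  let v := radd phi t u in let H j := radd (F j) t (G j) in
  form W v H v H = form W phi F phi F + 2 * t * form W phi F u G + t ^+ 2 * form W u G u G.
Proof.
move=> mW LF LG Wphi Wu v H; rewrite /form wdot_radd//.
under eq_bigr => j _.
  rewrite wdot_radd//; [over|exact/L2_wL2|exact/L2_wL2].
rewrite /= !big_split/= -!mulr_sumr; ring.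
Qed.

(** Real part of the equation (H - s) u = phi tested against [psi]. *)
Lemma schroedinger_real W u G phi (s : R) :
  schroedinger (fun x => (W x)%:C%C) u (fun x => s%:C%C * u x + phi x) ->
  weak_gradient u G ->
  L2 phi -> forall psi H, form_domain (fun x => (W x)%:C%C) psi -> weak_gradient psi H ->
  form W u G psi H = wdot (cst 1) phi psi + s * wdot (cst 1) u psi.
Proof.
move=> [Du _ E] wG Lphi psi H Dpsi wH.
have [[Lu _] _] := Du; have [[Lpsi _] _] := Dpsi.
have <- := Re_L2inner_radd _ s _ _ Lphi Lu Lpsi.
have := congr1 (@complex.Re R) (E _ _ _ Dpsi wG wH).
rewrite (_ : (fun x => s%:C%C * u x + phi x) = radd phi s u); last by apply/funext => x; rewrite addrC.
move=> <-; have ReD (x y : R[i]) : Re (x + y) = Re x + Re y by case: x y => a b [].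
rewrite /form ReD Re_L2inner_real; congr (_ + _).
rewrite (big_morph (@complex.Re R) (id1 := 0) (op1 := +%R) ReD)//.
by apply: eq_bigr => j _; rewrite Re_L2inner.
Qed.

Lemma form_ge W (b : R) u G : measurable_fun setT W -> (forall x, - b <= W x) ->
  L2 u -> wL2 W u -> - b * wdot (cst 1) u u <= form W u G u G.
Proof.
move=> mW Wb /L2_wL2 Lu Wu.
rewrite -[leLHS]add0r lerD//; first by apply: sumr_ge0 => j _; exact: wdot_ge0.
rewrite /wdot -RintegralZl//; last by case: Lu.
apply: le_Rintegral => //; last by move=> x _; rewrite mul1r ler_wpM2r ?rdot_ge0.
- by apply: integrableZl_fin; case: Lu.
- by case: Wu.
Qed.

(** As [psi] is a trial function, the infimum [s] of all Rayleigh quotients is at most [mu]; what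
    remains is that [s] lies in the spectrum. *)
Lemma inf_spec_le W (b mu : R) psi G : measurable_fun setT W ->
  (forall x, - b <= W x) -> form_domain (fun x => (W x)%:C%C) psi ->
  weak_gradient psi G -> 0 < wdot (cst 1) psi psi ->
  form W psi G psi G <= mu * wdot (cst 1) psi psi -> (inf_spec W <= mu%:E)%E.
Proof.
move=> mW Wb Dpsi wG psi0 psimu.
pose N u := wdot (cst 1) u u.
pose S := [set q | exists u H, [/\ form_domain (fun x => (W x)%:C%C) u,
   weak_gradient u H, 0 < N u & q = form W u H u H / N u]].
have DL2 u : form_domain (fun x => (W x)%:C%C) u -> L2 u by case=> -[].
have DwL2 u : form_domain (fun x => (W x)%:C%C) u -> wL2 W u.
  by move=> /form_domain_realP[].
have Sb : lbound S (- b).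
  move=> _ [u [H [Du wH u0 ->]]]; rewrite ler_pdivlMr//.
  by apply: form_ge => //; [exact: DL2|exact: DwL2].
have SG : S (form W psi G psi G / N psi) by exists psi, G.
have infS : has_inf S by split; [exists (form W psi G psi G / N psi)|exists (- b)].
pose s := inf S.
have form_s u H : form_domain (fun x => (W x)%:C%C) u -> weak_gradient u H ->
    s * N u <= form W u H u H.
  move=> Du wH; have [u0|u0] := ltP 0 (N u).
    by rewrite -ler_pdivlMr//; apply: ge_inf; [exists (- b)|exists u, H].
  (* No quotient exists here, but semiboundedness already makes the form nonnegative. *)
  have Nu : N u = 0 by apply/eqP; rewrite eq_le u0 wdot_ge0.
  have := form_ge _ _ _ H mW Wb (DL2 _ Du) (DwL2 _ Du).
  by rewrite -/(N u) Nu !mulr0.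
suff spec_s : spectrum (fun x => (W x)%:C%C) s%:C%C.
  apply: (@le_trans _ _ s%:E); first by apply: ereal_inf_lbound; exists s.
  by rewrite lee_fin (le_trans (ge_inf _ SG))//; [exists (- b)|rewrite ler_pdivrMr].
(* If [s] is in the resolvent set, the solution [u] of (H - s) u = phi satisfies Re <phi, u> <= K
   |phi|^2. From this [s + K^-1] turns out to be a lower bound of [S], which is absurd. *)
move=> [_ [M hM]]; pose K := 1 + M ^+ 2.
have K0 : 0 < K by rewrite ltr_pwDl// sqr_ge0.
have : s + K^-1 <= s; last by rewrite gerDl leNgt invr_gt0 K0.
apply: lb_le_inf; first by case: infS.
move=> _ [phi [F [Dphi wF phi0 ->]]]; rewrite ler_pdivlMr//.
have Lphi := DL2 _ Dphi; have [u [Hu uM]] := hM _ Lphi.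
have [Du _ _] := Hu; have [[Lu [H wH]] _] := Du.
have uphi : wdot (cst 1) phi u <= K * N phi.
  rewrite (le_trans (wdot1_le _ _ Lphi Lu))// mulrDl mul1r lerD2l.
  rewrite /N -!L2norm_sqr -exprMn lerXn2r// nnegrE; first exact: sqrtr_ge0.
  by apply: le_trans uM; exact: sqrtr_ge0.
have E1 := schroedinger_real _ _ _ _ _ Hu wH Lphi _ _ Dphi wF.
have E2 := schroedinger_real _ _ _ _ _ Hu wH Lphi _ _ Du wH.
(* After the resolvent equation is inserted, nonnegativity of q - s at phi + t u reads q(phi) - s
   |phi|^2 + 2 t |phi|^2 + t^2 Re <phi, u> >= 0. For t = -1/K the last term is at most |phi|^2 / K,
   half of what the term before it removes. *)
pose t := - K^-1.
pose v := radd phi t u; pose I j := radd (F j) t (H j).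
have wI : weak_gradient v I by exact: weak_gradient_radd.
have Dv : form_domain (fun x => (W x)%:C%C) v.
  apply/form_domain_realP => //; split; last by apply: wL2_radd => //; exact: DwL2.
  split; last by exists I.
  by apply/L2_wL2; apply: wL2_radd => //; exact/L2_wL2.
have := form_s _ _ Dv wI.
rewrite form_radd//; [|by move=> j; case: (wF j)|by move=> j; case: (wH j)
  |exact: DwL2|exact: DwL2].
rewrite /N wdot_radd//; [|exact/L2_wL2|exact/L2_wL2].
rewrite (formC W phi) E1 E2 (wdotC _ u phi) -/(N phi) -/(N u) => h.
have tu : t ^+ 2 * wdot (cst 1) phi u <= K^-1 * N phi.
  by rewrite /t sqrrN expr2 -mulrA ler_wpM2l// ?ler_pdivrMl// invr_ge0 ltW.
rewrite mulrDl /t in h tu *; lra.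
Qed.

End variational_principle.

(** * Truncation of the negative part of a real potential *)

Section truncation.
Context {R : realType} {d : nat}.
Local Notation Rd := 'rV[R]_d.
Local Notation leb := (lebesgue_rV d).
Local Notation Re := complex.Re.
Local Notation Im := complex.Im.
Implicit Types (U w : Rd -> R) (A : (set Rd)^nat).

(** The positive part of [U] is kept; the negative part is cut at [n] on [A n] and removed
    elsewhere. *)
Definition truncation U A (n : nat) (x : Rd) : R :=
  Num.max (U x) (- (n%:R * \1_(A n) x)).

Lemma norm_truncation U A n x : `|truncation U A n x| <= `|U x|.
Proof.
rewrite /truncation; have : 0 <= n%:R * \1_(A n) x :> R by rewrite mulr_ge0.
case: (leP 0 (U x)) => U0 h.
  by rewrite max_l// (le_trans _ U0)// oppr_le0.
rewrite (ltr0_norm U0) ler_norml opprK; apply/andP; split.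
  by rewrite le_max lexx.
rewrite ge_max; apply/andP; split; lra.
Qed.

Lemma truncation_ge U A n x : - n%:R <= truncation U A n x.
Proof.
rewrite /truncation le_max lerN2; apply/orP; right.
by rewrite ler_piMr// indicE; case: (x \in A n).
Qed.

Lemma measurable_truncation U A n : measurable_fun setT U -> measurable (A n) ->
  measurable_fun setT (truncation U A n).
Proof.
move=> mU mA; apply: measurable_maxr => //; apply: measurableT_comp => //.
by apply: measurable_funM => //; exact: measurable_indic.
Qed.

(** The values agree as soon as [x] is in [A n] and [n] exceeds |U x|. *)
Lemma truncation_cvg U A x : \bigcup_n A n = setT ->
  {homo A : m n / (m <= n)%N >-> m `<=` n} ->
  \forall n \near \oo, truncation U A n x = U x.
Proof.
move=> AT ndA; have [m _ Amx] : (\bigcup_n A n) x by rewrite AT.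
near=> n; apply/max_idPl.
have Anx : A n x by apply: (ndA m n) => //; near: n; exact: nbhs_infty_ge.
rewrite indicE mem_set// mulr1 lerNl (le_trans (ler_norm _))// normrN.
by near: n; exact: nbhs_infty_ger.
Unshelve. all: end_near. Qed.

Lemma neg_part_ge0 (t : R) : 0 <= neg_part t.
Proof. by rewrite /neg_part le_max lexx. Qed.

Lemma neg_part_le (s t : R) : s <= t -> neg_part t <= neg_part s.
Proof.
by move=> st; rewrite /neg_part ge_max !le_max lexx/= lerN2 st orbT.
Qed.

Lemma neg_part_le_norm (t : R) : neg_part t <= `|t|.
Proof. by rewrite /neg_part ge_max normr_ge0 -normrN ler_norm. Qed.

Lemma measurable_neg_powR w (p : R) : measurable_fun setT w ->
  measurable_fun setT (fun x => (neg_part (w x) `^ p)%:E).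
Proof.
move=> mw; apply/measurable_EFinP.
apply: (@measurableT_comp _ _ _ _ _ _ (@powR R ^~ p)); first exact: measurable_powR.
by apply: measurable_maxr => //; exact: measurableT_comp.
Qed.

Lemma integral_neg_truncation_le U A n (p : R) : 0 <= p ->
  measurable_fun setT U -> measurable (A n) ->
  (\int[leb]_x (neg_part (truncation U A n x) `^ p)%:E <=
   \int[leb]_x (neg_part (U x) `^ p)%:E)%E.
Proof.
move=> p0 mU mA; apply: ge0_le_integral => //.
- by move=> x _; rewrite lee_fin powR_ge0.
- by apply: measurable_neg_powR; exact: measurable_truncation.
- exact: measurable_neg_powR.
move=> x _; rewrite lee_fin ge0_ler_powR// ?nnegrE ?neg_part_ge0//.
by apply: neg_part_le; rewrite le_max lexx.
Qed.

(** The integrand is at most n^p on [A n] and vanishes elsewhere. *)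
Lemma integral_neg_truncation_lty U A n (p : R) : 0 < p ->
  measurable_fun setT U -> measurable (A n) -> (leb (A n) < +oo)%E ->
  (\int[leb]_x (neg_part (truncation U A n x) `^ p)%:E < +oo)%E.
Proof.
move=> p0 mU mA Aoo.
apply: (@le_lt_trans _ _ (\int[leb]_x ((n%:R `^ p)%:E * (\1_(A n) x)%:E))%E).
  apply: ge0_le_integral => //.
  - by move=> x _; rewrite lee_fin powR_ge0.
  - by apply: measurable_neg_powR; exact: measurable_truncation.
  - by apply/measurable_EFinP; apply: measurable_funM => //; exact: measurable_indic.
  move=> x _; rewrite -EFinM lee_fin indicE.
  have : neg_part (truncation U A n x) <= n%:R * (x \in A n)%:R.
    rewrite /neg_part ge_max mulr_ge0//= lerNl /truncation le_max indicE lexx.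
    by rewrite orbT.
  case: (x \in A n) => /=; rewrite ?mulr1 ?mulr0.
    by move=> h; rewrite ge0_ler_powR ?nnegrE ?neg_part_ge0// ltW.
  move=> h; have -> : neg_part (truncation U A n x) = 0.
    by apply/eqP; rewrite eq_le h neg_part_ge0.
  (* Positivity of [p] matters here, as 0 to the power 0 is 1. *)
  by rewrite powR0// gt_eqF.
rewrite ge0_integralZl ?lee_fin ?powR_ge0//; last first.
  by apply/measurable_EFinP; exact: measurable_indic.
by rewrite integral_indic// setIT lte_mul_pinfty// lee_fin powR_ge0.
Qed.

(** Dominated convergence with majorant |U| |psi|^2. *)
Lemma wdot_truncation_cvg U A psi : measurable_fun setT U ->
  (forall n, measurable (A n)) -> \bigcup_n A n = setT ->
  {homo A : m n / (m <= n)%N >-> m `<=` n} -> wL2 U psi ->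
  wdot (truncation U A n) psi psi @[n --> \oo] --> wdot U psi psi.
Proof.
move=> mU mA AT ndA [mpsi Ipsi]; apply: fine_cvg.
rewrite /wdot /Rintegral fineK; last exact: integrable_fin_num.
have mr := measurable_rdot _ _ mpsi mpsi.
apply: (@dominated_cvg _ _ _ _ _ measurableT _ _
  (abse \o (fun x => (U x * rdot (psi x) (psi x))%:E))).
- move=> n; apply/measurable_EFinP; apply: measurable_funM => //.
  exact: measurable_truncation.
- move=> x _; apply: cvg_near_cst.
  by have := truncation_cvg U A x AT ndA; apply: filterS => n ->.
- by [].
- exact: integrable_abse.
- move=> n x _; rewrite /= lee_fin !normrM ler_wpM2r//.
  exact: norm_truncation.
Qed.

End truncation.

(** * Eigenvalue bound through the real potential Re V + t Im V *)

Section eigenvalue_bound.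
Context {R : realType} {d : nat}.
Local Notation Rd := 'rV[R]_d.
Local Notation leb := (lebesgue_rV d).
Local Notation Re := complex.Re.
Local Notation Im := complex.Im.
Implicit Types (U W w : Rd -> R) (V psi : Rd -> R[i]) (G : 'I_d -> Rd -> R[i]).

Lemma wdot1_gt0 psi : L2 psi -> ~ {ae leb, forall x, psi x = 0} ->
  0 < wdot (cst 1) psi psi.
Proof.
move=> /L2_wL2[mpsi Ipsi] npsi; rewrite lt0r wdot_ge0// andbT.
apply/eqP => psi0; apply: npsi.
have mr := measurable_rdot _ _ mpsi mpsi.
have : (\int[leb]_x `|(cst 1 x * rdot (psi x) (psi x))%:E| = 0)%E.
  under eq_integral do rewrite abse_EFin ger0_norm ?mulr_ge0 ?rdot_ge0//.
  by rewrite -[LHS]fineK ?integrable_fin_num// -[fine _]/(wdot (cst 1) psi psi) psi0.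
move/(ae_eq_integral_abs leb measurableT); have mr1 : measurable_fun setT
  (fun x => (cst 1 x * rdot (psi x) (psi x))%:E).
  by apply/measurable_EFinP; exact: measurable_funM.
move=> /(_ mr1); apply: filterS => x /(_ I) /= [].
rewrite mul1r -cnorm_sqr => /eqP; rewrite sqrf_eq0 => /eqP.
exact: ComplexField.Normc.eq0_normc.
Qed.

Lemma norm_Re_Im_le (z : R[i]) (t : R) : `|Re z + t * Im z| <= (1 + `|t|) * cnorm z.
Proof.
rewrite (le_trans (ler_normD _ _))// mulrDl mul1r lerD ?normr_Re_le//.
by rewrite normrM ler_wpM2l// normr_Im_le.
Qed.

(** Test the eigenvalue equation with [psi] and add [t] times its imaginary part to its real
    part. *)
Lemma eigenfunction_form V (lambda : R[i]) (t : R) psi G : cmeasurable V ->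
  schroedinger V psi (fun x => lambda * psi x) -> weak_gradient psi G ->
  form (fun x => Re (V x) + t * Im (V x)) psi G psi G =
  (Re lambda + t * Im lambda) * wdot (cst 1) psi psi.
Proof.
move=> mV [Dpsi _ E] wG; have [[Lpsi _] _] := Dpsi.
have [mVr mVi] := mV.
have WRe : wL2 (fun x => Re (V x)) psi.
  by apply: (form_domain_wL2 V _ 1) => // x; rewrite mul1r normr_Re_le.
have WIm : wL2 (fun x => Im (V x)) psi.
  by apply: (form_domain_wL2 V _ 1) => // x; rewrite mul1r normr_Im_le.
have [_ I1] : wL2 (cst 1) psi by exact/L2_wL2.
have Ereim := E _ _ _ Dpsi wG wG.
have ReM (v : Rd -> R[i]) :
    Re (L2inner (fun x => v x * psi x) psi) = wdot (fun x => Re (v x)) psi psi.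
  apply: eq_Rintegral => x _; rewrite /rdot.
  by case: (v x) (psi x) => a b [c e] /=; ring.
have ImM (v : Rd -> R[i]) :
    Im (L2inner (fun x => v x * psi x) psi) = wdot (fun x => Im (v x)) psi psi.
  apply: eq_Rintegral => x _; rewrite /rdot.
  by case: (v x) (psi x) => a b [c e] /=; ring.
have ReD (x y : R[i]) : Re (x + y) = Re x + Re y by case: x y => a b [].
have ImD (x y : R[i]) : Im (x + y) = Im x + Im y by case: x y => a b [].
have cst1 (a : R) : wdot (fun=> a) psi psi = a * wdot (cst 1) psi psi.
  rewrite -RintegralZl//; apply: eq_Rintegral => x _; congr (_ * _).
  by rewrite mul1r.
have ERe : \sum_(j < d) wdot (cst 1) (G j) (G j) + wdot (fun x => Re (V x)) psi psi =
    Re lambda * wdot (cst 1) psi psi.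
  have := congr1 (@complex.Re R) Ereim; rewrite ReD -cst1.
  rewrite (big_morph (@complex.Re R) (id1 := 0) (op1 := +%R) ReD)//.
  under eq_bigr do rewrite Re_L2inner.
  by rewrite !ReM.
have EIm : wdot (fun x => Im (V x)) psi psi = Im lambda * wdot (cst 1) psi psi.
  have := congr1 (@complex.Im R) Ereim; rewrite ImD -cst1.
  rewrite (big_morph (@complex.Im R) (id1 := 0) (op1 := +%R) ImD)//.
  (* The gradient term is real, so only the potential contributes to the imaginary part. *)
  rewrite big1 => [|j _]; last first.
    have -> : Im (L2inner (G j) (G j)) = \int[leb]_x (0 : R).
      by apply: eq_Rintegral => x _; case: (G j x) => a b /=; ring.
    by rewrite /Rintegral integral0.
  by rewrite add0r !ImM.
rewrite mulrDl -ERe -mulrA -EIm /form -addrA; congr (_ + _).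
rewrite /wdot -RintegralZl//; last by case: WIm.
rewrite -RintegralD//; [|by case: WRe|by apply: integrableZl_fin; case: WIm].
by apply: eq_Rintegral => x _; ring.
Qed.

(** Makes the truncated potentials admissible in the definition of the sharp constant. *)
Lemma L1loc_real V w (k : R) : L1loc V -> measurable_fun setT w -> 0 <= k ->
  (forall x, `|w x| <= k * cnorm (V x)) -> L1loc (fun x => (w x)%:C%C).
Proof.
move=> [mV Vloc] mw k0 wV; split; first by split.
move=> K cK; have mK := compact_measurable_rV _ cK.
have mVK : measurable_fun K (fun x => (cnorm (V x))%:E).
  by apply/measurable_EFinP; apply: measurable_funTS; exact: measurable_cnorm.
apply: (@le_lt_trans _ _ (\int[leb]_(x in K) (k%:E * (cnorm (V x))%:E))%E).
  apply: ge0_le_integral => //.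
  - by move=> x _; rewrite lee_fin cnorm_ge0.
  - apply/measurable_EFinP; apply: measurable_funTS; apply: measurable_cnorm.
    by split.
  - exact: emeasurable_funM.
  - by move=> x _; rewrite cnorm_real -EFinM lee_fin.
rewrite ge0_integralZl//; last by move=> x _; rewrite lee_fin cnorm_ge0.
by rewrite lte_mul_pinfty// ?lee_fin//; exact: Vloc.
Qed.

Lemma neg_pow_le (x y : \bar R) (gamma : R) : 0 <= gamma -> (x <= y)%E ->
  (neg_pow y gamma <= neg_pow x gamma)%E.
Proof.
move=> g0 xy; rewrite /neg_pow; case: ifPn => [y0|_]; last first.
  by case: ifP => // _; exact: poweR_ge0.
rewrite (le_lt_trans xy y0) gt0_ler_poweR//.
- by rewrite in_itv/= leey andbT oppe_ge0 ltW.
- by rewrite in_itv/= leey andbT oppe_ge0 ltW// (le_lt_trans xy y0).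
- by rewrite leeN2.
Qed.

(** Common source of all the bounds, which differ in the choice of [t]. The inequality is proved for
    truncations, where the variational principle applies, and then passed to the limit. *)
Lemma eigenvalue_bound (gamma t : R) V (lambda : R[i]) :
  0 <= gamma -> 0 < gamma + d%:R / 2 -> L1loc V ->
  schroedinger_eigenvalue V lambda -> Re lambda + t * Im lambda < 0 ->
  (((- (Re lambda + t * Im lambda)) `^ gamma)%:E <=
   sharp_constant gamma d * \int[leb]_x
     (neg_part (Re (V x) + t * Im (V x))%R `^ (gamma + d%:R / 2))%:E)%E.
Proof.
set mu := Re lambda + _; set p := gamma + _; pose U x := Re (V x) + t * Im (V x).
move=> g0 p0 LV [psi [Lpsi npsi Hpsi]] mu0.
have [mV _] := LV; have [mVr mVi] := mV.
have [Dpsi _ _] := Hpsi; have [[_ [G wG]] _] := Dpsi.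
have N0 := wdot1_gt0 _ Lpsi npsi; set N := wdot (cst 1) psi psi in N0.
have formU : form U psi G psi G = mu * N := eigenfunction_form _ _ t _ _ mV Hpsi wG.
have mU : measurable_fun setT U.
  by apply: measurable_funD => //; exact: measurable_funM.
have UV x : `|U x| <= (1 + `|t|) * cnorm (V x) by exact: norm_Re_Im_le.
have k0 : 0 <= 1 + `|t| by rewrite addr_ge0.
have WU : wL2 U psi by exact: (form_domain_wL2 V _ (1 + `|t|)).
have /sigma_finiteP[A [AT ndA Aoo]] := sigma_finiteT (@lebesgue_rV R d).
have mA n : measurable (A n) by case: (Aoo n).
have ndA' : {homo A : m n / (m <= n)%N >-> m `<=` n}.
  by move=> m n mn; exact/subsetPset/ndA.
pose W := truncation U A.
have mW n : measurable_fun setT (W n) by exact: measurable_truncation.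
have WV n x : `|W n x| <= (1 + `|t|) * cnorm (V x).
  by rewrite (le_trans (norm_truncation _ _ _ _)).
(* Rayleigh quotient of the fixed function [psi] for the truncated potential. *)
pose mu_ n := form (W n) psi G psi G / N.
have mu_cvg : mu_ n @[n --> \oo] --> mu.
  rewrite -[mu](mulfK (lt0r_neq0 N0)) -formU.
  apply: cvgMl; apply: cvgD; first exact: cvg_cst.
  by apply: wdot_truncation_cvg => //; rewrite -AT.
pose I_ n := (\int[leb]_x (neg_part (W n x) `^ p)%:E)%E.
have I_lty n : (I_ n < +oo)%E.
  by apply: integral_neg_truncation_lty => //; case: (Aoo n).
set I := (\int[leb]_x _)%E.
have I_le n : (I_ n <= I)%E by apply: integral_neg_truncation_le => //; exact: ltW.
have I_ge0 n : (0 <= I_ n)%E.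
  by apply: integral_ge0 => x _; rewrite lee_fin powR_ge0.
set S := [set C : R | 0 <= C /\ forall w : Rd -> R, L1loc (fun x => (w x)%:C%C) ->
  (neg_pow (inf_spec w) gamma <= C%:E * \int[leb]_x (neg_part (w x) `^ p)%:E)%E].
have SP C n : S C -> mu_ n < 0 -> (((- mu_ n) `^ gamma)%:E <= C%:E * I_ n)%E.
  move=> [C0 /(_ (W n) (L1loc_real _ _ _ LV (mW n) k0 (WV n))) SC] mun0.
  apply: le_trans SC; have : (inf_spec (W n) <= (mu_ n)%:E)%E.
    apply: (inf_spec_le (W n) n%:R _ psi G) => //.
    - by move=> x; exact: truncation_ge.
    - apply/form_domain_realP => //; split; first by case: Dpsi.
      exact: (form_domain_wL2 V _ (1 + `|t|)).
    - by rewrite /mu_ mulfVK// lt0r_neq0.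
  move=> /(neg_pow_le _ _ _ g0); apply: le_trans.
  by rewrite /neg_pow lte_fin mun0.
have mu_lt0 : \forall n \near \oo, mu_ n < 0 by exact: cvgr_lt mu_cvg _ mu0.
have sharpE : sharp_constant gamma d = ereal_inf [set C%:E | C in S] by [].
(* One [n] with [mu_ n < 0] gives a positive lower bound for all admissible [C]. Adding 1 to the
   integral avoids a division by 0. *)
have sharp_gt0 : (0 < sharp_constant gamma d)%E.
  have [n _ /(_ _ (leqnn n)) mun0] := mu_lt0.
  have If : I_ n \is a fin_num by rewrite ge0_fin_numE.
  have r0 : 0 < fine (I_ n) + 1 by rewrite ltr_wpDl// fine_ge0.
  apply: (@lt_le_trans _ _ ((- mu_ n) `^ gamma / (fine (I_ n) + 1))%:E).
    by rewrite lte_fin divr_gt0// powR_gt0// oppr_gt0.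
  rewrite sharpE; apply: le_ereal_inf_tmp => _ [C SC <-].
  rewrite lee_fin ler_pdivrMr//; have := SP _ _ SC mun0; have [C0 _] := SC.
  rewrite -(fineK If) -EFinM lee_fin => /le_trans; apply.
  by rewrite ler_wpM2l// lerDl.
have I_gt0 : (0 < I)%E.
  rewrite lt_neqAle eq_sym; apply/andP; split; last first.
    by apply: integral_ge0 => x _; rewrite lee_fin powR_ge0.
  apply/eqP => I0; suff : 0 <= mu * N by rewrite leNgt pmulr_llt0// mu0.
  rewrite -formU; apply: addr_ge0; first by apply: sumr_ge0 => j _; exact: wdot_ge0.
  have mI := measurable_neg_powR _ p mU.
  have : ae_eq leb setT (fun x => (neg_part (U x) `^ p)%:E) (cst 0%E).
    apply/(ae_eq_integral_abs leb measurableT mI).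
    rewrite -I0; apply: eq_integral => x _.
    by rewrite abse_EFin ger0_norm// powR_ge0.
  move=> U0; rewrite /wdot /Rintegral.
  (* [neg_part (- U x)] is the positive part of [U], equal to [U] almost everywhere when the
     integral of the power of the negative part is 0. *)
  rewrite (ae_eq_integral (fun x => (neg_part (- U x) * rdot (psi x) (psi x))%:E))//.
  - apply: fine_ge0; apply: integral_ge0 => x _.
    by rewrite lee_fin mulr_ge0 ?neg_part_ge0 ?rdot_ge0.
  - by case: WU => _ /integrableP[].
  - apply/measurable_EFinP; apply: measurable_funM; last first.
      by case: Lpsi => mpsi _; exact: measurable_rdot.
    by apply: measurable_maxr => //; do 2 apply: measurableT_comp => //.
  apply: filterS U0 => x /(_ Logic.I) /= [/powR_eq0_eq0] Ux _; congr (_ * _)%:E.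
  move: Ux; rewrite /neg_part opprK => Ux.
  rewrite max_r// -oppr_le0 -Ux le_max lexx orbT//.
(* For an infinite integral the right-hand side is infinite, because the sharp constant is
   positive. *)
have [Ioo|] := eqVneq I +oo%E; first by rewrite Ioo gt0_muley// leey.
rewrite -ltey => Ioo; have If : I \is a fin_num by rewrite ge0_fin_numE// ltW.
have r0 : 0 < fine I by rewrite fine_gt0// I_gt0.
rewrite -(fineK If).
(* Division by the integral turns the claim into a lower bound for each admissible [C], which also
   covers an infinite sharp constant. *)
have -> : (- mu) `^ gamma = (- mu) `^ gamma / fine I * fine I.
  by rewrite mulfVK// lt0r_neq0.
rewrite EFinM; apply: lee_wpmul2r; first by rewrite lee_fin ltW.
rewrite sharpE; apply: le_ereal_inf_tmp => _ [C SC <-].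
rewrite lee_fin ler_pdivrMr//.
(* For fixed [C], let n tend to infinity in (- mu_n)^gamma <= C I_n <= C I; the power is continuous
   at - mu > 0. *)
have powR_cvg : (- mu_ n) `^ gamma @[n --> \oo] --> (- mu) `^ gamma.
  have cpow : {for - mu, continuous (@powR R ^~ gamma)}.
    apply: differentiable_continuous; apply/derivable1_diffP.
    by apply: derivable_powR; rewrite in_itv/= oppr_gt0 mu0.
  have muN_cvg : - mu_ n @[n --> \oo] --> - mu by exact: cvgN.
  exact: (continuous_cvg _ cpow muN_cvg).
rewrite -(cvg_lim _ powR_cvg)//; apply: limr_le; first by apply/cvg_ex; eexists; exact: powR_cvg.
apply: filterS mu_lt0 => n mun0; rewrite -lee_fin EFinM fineK//.
have [C0 _] := SC.
by rewrite (le_trans (SP _ _ SC mun0))// lee_wpmul2l// lee_fin.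
Qed.

End eigenvalue_bound.

(** * From Re V + t Im V to the modulus of V *)

Section complex_potential.
Context {R : realType} {d : nat}.
Local Notation leb := (lebesgue_rV d).
Local Notation Re := complex.Re.
Local Notation Im := complex.Im.

Lemma cnorm_le_Re_Im (z : R[i]) : cnorm z <= `|Re z| + `|Im z|.
Proof.
case: z => a b /=; rewrite -[leRHS]ger0_norm ?addr_ge0// -sqrtr_sqr ler_wsqrtr//.
rewrite sqrrD !real_normK ?num_real// addrAC lerDl.
by rewrite mulrn_wge0// mulr_ge0.
Qed.

(** Since (a + t b)^2 + (t a - b)^2 = (1 + t^2) |z|^2, the left side is at most sqrt(1 + t^2) |z|,
    and 1 and t^2 are both at most kappa^2. The factor sqrt 2 becomes the constant in
    [complex_constant]. *)
Lemma norm_Re_Im_le_sqrt2 (z : R[i]) (t kappa : R) : 1 <= kappa -> `|t| <= kappa ->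
  `|Re z + t * Im z| <= Num.sqrt 2 * kappa * cnorm z.
Proof.
case: z => a b k1 tk; have k0 : 0 <= kappa by apply: le_trans k1.
rewrite -[leLHS]sqrtr_sqr /= -[kappa in leRHS]ger0_norm// -sqrtr_sqr.
rewrite -!sqrtrM ?mulr_ge0 ?sqr_ge0// ler_wsqrtr//.
have t2 : t ^+ 2 <= kappa ^+ 2 by rewrite -real_normK ?num_real// lerXn2r// nnegrE.
have k2 : 1 <= kappa ^+ 2 by rewrite exprn_ege1.
have := sqr_ge0 (t * a - b).
have := mulr_ge0 (sqr_ge0 a) (_ : 0 <= kappa ^+ 2 - t ^+ 2).
have := mulr_ge0 (sqr_ge0 b) (_ : 0 <= kappa ^+ 2 - t ^+ 2).
have := mulr_ge0 (sqr_ge0 a) (_ : 0 <= kappa ^+ 2 - 1).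
have := mulr_ge0 (sqr_ge0 b) (_ : 0 <= kappa ^+ 2 - 1).
rewrite !subr_ge0 => /(_ k2) h1 /(_ k2) h2 /(_ t2) h3 /(_ t2) h4 h5.
move: h1 h2 h3 h4 h5; rewrite !expr2; lra.
Qed.

Lemma sharp_constant_ge0 (gamma : R) : (0 <= sharp_constant gamma d)%E.
Proof. by apply: le_ereal_inf_tmp => _ [C [C0 _] <-]; rewrite lee_fin. Qed.

Lemma complex_eigenvalue_bound (gamma kappa : R) (V : 'rV[R]_d -> R[i])
    (lambda : R[i]) :
  0 <= gamma -> 0 < gamma + d%:R / 2 -> L1loc V ->
  schroedinger_eigenvalue V lambda -> lambda != 0 -> 1 <= kappa ->
  Re lambda - kappa * `|Im lambda| <= - cnorm lambda ->
  ((cnorm lambda `^ gamma)%:E <= complex_constant gamma d *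
     (kappa `^ (gamma + d%:R / 2))%:E *
     \int[leb]_x (cnorm (V x) `^ (gamma + d%:R / 2))%:E)%E.
Proof.
move=> g0; set p := gamma + _ => p0 LV eigV l0 k1 hk.
have [mV _] := LV; have [mVr mVi] := mV.
(* The sign makes t Im lambda equal to - kappa |Im lambda|, whence Re lambda + t Im lambda <= -
   |lambda| by [hk]. *)
pose t := - (kappa * Num.sg (Im lambda)).
have tIm : t * Im lambda = - (kappa * `|Im lambda|).
  by rewrite /t mulNr -mulrA -normrEsg.
have k0 : 0 <= kappa by apply: le_trans k1.
have tk : `|t| <= kappa.
  rewrite normrN normrM normr_sg ger0_norm// ler_piMr//.
  by case: (_ != _).
have n0 : 0 < cnorm lambda.
  rewrite lt0r cnorm_ge0 andbT; apply: contra l0 => /eqP.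
  by move=> /ComplexField.Normc.eq0_normc ->.
have mu0 : Re lambda + t * Im lambda < 0.
  by rewrite tIm (le_lt_trans hk)// oppr_lt0.
apply: (@le_trans _ _ ((- (Re lambda + t * Im lambda)) `^ gamma)%:E).
  rewrite lee_fin ge0_ler_powR// ?nnegrE ?cnorm_ge0//.
    by rewrite oppr_ge0 ltW.
  by rewrite lerNr tIm.
apply: (le_trans (eigenvalue_bound _ _ _ _ g0 p0 LV eigV mu0)); rewrite -/p.
(* With p = gamma + d/2, the power p of sqrt 2 is 2^(gamma/2 + d/4). *)
have -> : complex_constant gamma d =
    (sharp_constant gamma d * (Num.sqrt 2 `^ p)%:E)%E.
  rewrite /complex_constant muleC -powR12_sqrt// -powRrM; congr (_ * (_ `^ _)%:E)%E.
  by rewrite /p; field.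
rewrite -!muleA lee_wpmul2l ?sharp_constant_ge0// muleA -EFinM.
rewrite -powRM ?sqrtr_ge0//.
rewrite -ge0_integralZl//; last 3 first.
- apply/measurable_EFinP; apply: (@measurableT_comp _ _ _ _ _ _ (@powR R ^~ p)).
    exact: measurable_powR.
  exact: measurable_cnorm.
- by move=> x _; rewrite lee_fin powR_ge0.
- by rewrite lee_fin powR_ge0.
apply: ge0_le_integral => //.
- by move=> x _; rewrite lee_fin powR_ge0.
- apply: measurable_neg_powR; apply: measurable_funD => //.
  exact: measurable_funM.
- apply/measurable_EFinP; apply: measurable_funM => //.
  apply: (@measurableT_comp _ _ _ _ _ _ (@powR R ^~ p)); first exact: measurable_powR.
  exact: measurable_cnorm.
move=> x _; rewrite -EFinM lee_fin -powRM ?mulr_ge0 ?sqrtr_ge0 ?cnorm_ge0//.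
apply: (ge0_ler_powR (ltW p0)); rewrite ?nnegrE ?neg_part_ge0//.
  by rewrite !mulr_ge0 ?sqrtr_ge0 ?cnorm_ge0.
by rewrite (le_trans (neg_part_le_norm _))// norm_Re_Im_le_sqrt2.
Qed.

End complex_potential.

(** * Bounds for eigenvalues in the left and right half-planes *)

Theorem theorem2 (R : realType) (d : nat) (gamma : R)
  (hgamma : [\/ d = 1%N /\ 1 / 2 <= gamma,
                d = 2%N /\ 0 < gamma |
                (3 <= d)%N /\ 0 <= gamma])
  (V : 'rV[R]_d -> R[i]) (hV : L1loc V)
  (lambda : R[i]) (hlambda : schroedinger_eigenvalue V lambda)
  (hcut : ~ (complex.Im lambda = 0 /\ 0 <= complex.Re lambda)) :
  (complex.Re lambda <= 0 ->
     (neg_pow (complex.Re lambda)%:E gamma <=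
      sharp_constant gamma d *
      \int[lebesgue_rV d]_x
        (neg_part (complex.Re (V x)) `^ (gamma + d%:R / 2))%:E)%E /\
     ((cnorm lambda `^ gamma)%:E <=
      complex_constant gamma d *
      \int[lebesgue_rV d]_x (cnorm (V x) `^ (gamma + d%:R / 2))%:E)%E) /\
  (0 <= complex.Re lambda ->
     ((cnorm lambda `^ gamma)%:E <=
      complex_constant gamma d *
      ((1 + 2 * complex.Re lambda / `|complex.Im lambda|) `^ (gamma + d%:R / 2))%:E *
      \int[lebesgue_rV d]_x (cnorm (V x) `^ (gamma + d%:R / 2))%:E)%E).
Proof.
have g0 : 0 <= gamma.
  by case: hgamma => -[_]; [apply: le_trans|exact: ltW|].
have d0 : (0 < d)%N by case: hgamma => -[]; [move=> ->|move=> ->|case: (d)].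
have p0 : 0 < gamma + d%:R / 2 by rewrite ltr_wpDl// divr_gt0// ltr0n.
have l0 : lambda != 0.
  by apply/eqP => l0; apply: hcut; rewrite l0.
split=> [Re0|Re0]; first split.
(* For Re lambda = 0 the left side is 0 by convention, even at gamma = 0; otherwise take t = 0. *)
- rewrite /neg_pow lte_fin; case: ltP => [Rel|_]; last first.
    rewrite mule_ge0 ?sharp_constant_ge0//.
    by apply: integral_ge0 => x _; rewrite lee_fin powR_ge0.
  have := eigenvalue_bound _ 0 _ _ g0 p0 hV hlambda.
  rewrite mul0r addr0 => /(_ Rel).
  by under eq_integral do rewrite mul0r addr0.
(* With kappa = 1 the shifted value is -(|Re lambda| + |Im lambda|) <= - |lambda|. *)
- have := complex_eigenvalue_bound _ 1 _ _ g0 p0 hV hlambda l0 (lexx _).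
  rewrite powR1 mule1; apply.
  rewrite mul1r; have := cnorm_le_Re_Im lambda; rewrite (ler0_norm Re0); lra.
(* The cut plane excludes Im lambda = 0 here. With kappa = 1 + 2 Re lambda / |Im lambda| the value
   Re lambda - kappa |Im lambda| is again -(|Re lambda| + |Im lambda|). *)
- have Im0 : 0 < `|complex.Im lambda|.
    rewrite normr_gt0; apply/eqP => Im0; exact: hcut.
  apply: complex_eigenvalue_bound => //.
    by rewrite lerDl divr_ge0 ?normr_ge0// mulr_ge0.
  rewrite mulrDl mul1r mulfVK ?gt_eqF//.
  have := cnorm_le_Re_Im lambda; rewrite (ger0_norm Re0); lra.
Qed.
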